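(* Let $n,m\ge 1$, $\mathcal X\subseteq\mathbb Z^p\times\mathbb R^{n-p}$ with $0\le p\le n$, and for every $i\in[m]$ let $\mathcal U_i\subseteq\mathbb R^{L_i}$, $\overline u^i\in\mathcal U_i$ and $f_i:\mathbb R^n\times\mathcal U_i\to\mathbb R$. Assume that for every $i\in[m]$: (i) there are a matrix $A^i\in\mathbb R^{L_i\times m_i}$ and a convex set $\mathcal Z_i\subseteq\mathbb R^{m_i}$ such that $\mathcal U_i=\{\overline u^i+A^i\zeta^i : \zeta^i\in\mathcal Z_i\}$; (ii) there is a function $l_i:\mathcal X\to\mathbb R^{L_i}$ with $f_i(x,u^i)=(u^i)^Tl_i(x)$ for all $u^i\in\mathcal U_i$ and $x\in\mathcal X$; (iii) $\overline u^i$ lies in the relative interior of $\mathcal U_i$. Let $\Gamma\in[m]$. Then the $\Gamma$-counterpart $$\inf_{x\in\mathcal X}\ \sup_{\mathcal S\subseteq[m]:|\mathcal S|\le\Gamma}\Big\{\sum_{i\in\mathcal S}\sup_{u^i\in\mathcal U_i}f_i(x,u^i)+\sum_{i\in[m]\setminus\mathcal S}f_i(x,\overline u^i)\Big\}$$ is equivalent to $$\begin{aligned}\inf_{x,p,\theta}\ &\Gamma\theta+\sum_{i\in[m]}\big((\overline u^i)^Tl_i(x)+p_i\big)\\ \text{s.t. }& x\in\mathcal X,\\ & p_i+\theta\ \ge\ \delta^*\big((A^i)^Tl_i(x)\mid\mathcal Z_i\big)\quad\forall i\in[m],\\ & p\in\mathbb R^m_{\ge0},\ \theta\in\mathbb 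R_{\ge0}.\end{aligned}$$
   Context: Notation: $[m]:=\{1,\dots,m\}$. For a non-empty set $\mathcal S\subseteq\mathbb R^d$ the support function is $\delta^*(z\mid\mathcal S):=\sup_{y\in\mathcal S}y^Tz\in\mathbb R\cup\{\infty\}$. A constraint whose right-hand side equals $+\infty$ is violated. Two minimization programs in $x$ (possibly with further auxiliary variables or indices) are called equivalent if they have the same optimal value in $[-\infty,\infty]$ and, whenever this value is finite, a point $x\in\mathcal X$ attains it in one program (for a suitable choice of the auxiliary variables or indices) if and only if it does so in the other. *)

(* Defs.v *)
From mathcomp Require Import all_boot all_order all_algebra archimedean.
From mathcomp Require Import all_classical all_reals all_analysis.
Import Order.TTheory GRing.Theory Num.Theory.
Import numFieldNormedType.Exports.

Set Implicit Arguments.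
Unset Strict Implicit.
Unset Printing Implicit Defensive.

Local Open Scope classical_set_scope.
Local Open Scope ring_scope.

Definition dotv (R : realType) (k : nat) (u v : 'cV[R]_k) : R :=
  (u^T *m v) ord0 ord0.

Definition support_fun (R : realType) (k : nat) (S : set 'cV[R]_k)
    (z : 'cV[R]_k) : \bar R :=
  ereal_sup [set (dotv y z)%:E | y in S].

Definition affine_hull (R : realType) (k : nat) (S : set 'cV[R]_k) :
    set 'cV[R]_k :=
  [set y | exists (r : nat) (v : 'I_r -> 'cV[R]_k) (c : 'I_r -> R),
    [/\ forall j, S (v j), \sum_j c j = 1 & y = \sum_j c j *: v j]].

Definition relative_interior (R : realType) (k : nat) (S : set 'cV[R]_k) :
    set 'cV[R]_k :=
  [set u | S u /\ \forall y \near u, affine_hull S y -> S y].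

Definition mixed_integer (R : realType) (n p : nat) : set 'cV[R]_n :=
  [set x | forall j : 'I_n, (j < p)%N -> x j ord0 \is a Num.int].

(* A feasible point of the program is a pair of the decision vector in V and
   the auxiliary variables; V alone is what programs are compared on. *)
Record program (R : realType) (V : Type) := Program {
  aux : Type;
  feasible : set (V * aux);
  objective : V * aux -> \bar R
}.

Definition optimal_value (R : realType) (V : Type) (P : program R V) : \bar R :=
  ereal_inf [set objective w | w in @feasible _ _ P].

Definition attains (R : realType) (V : Type) (P : program R V) (x : V) : Prop :=
  exists a : aux P, feasible (x, a) /\ objective (x, a) = optimal_value P.

Definition program_equiv (R : realType) (V : Type) (X : set V)
    (P Q : program R V) : Prop :=
  optimal_value P = optimal_value Q /\
  (optimal_value P \is a fin_num ->
   forall x, X x -> (attains P x <-> attains Q x)).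

(* The sums mixing extended and finite reals are only used with nonempty
   U i, where no summand is -oo. *)
Definition gamma_counterpart (R : realType) (n m : nat) (X : set 'cV[R]_n)
    (L : 'I_m -> nat) (U : forall i, set 'cV[R]_(L i))
    (ubar : forall i, 'cV[R]_(L i)) (f : forall i, 'cV[R]_n -> 'cV[R]_(L i) -> R)
    (Gamma : nat) : program R 'cV[R]_n :=
  {| aux := unit;
     feasible := [set w | X w.1];
     objective := fun w => ereal_sup
       [set (\sum_(i in S) ereal_sup [set (f i w.1 u)%:E | u in U i]
             + \sum_(i in ~: S) (f i w.1 (ubar i))%:E)%E
       | S in [set S : {set 'I_m} | (#|S| <= Gamma)%N]] |}.

(* The auxiliary variables are the pair (p, theta). *)
Definition gamma_reformulation (R : realType) (n m : nat) (X : set 'cV[R]_n)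
    (L k : 'I_m -> nat) (ubar : forall i, 'cV[R]_(L i))
    (A : forall i, 'M[R]_(L i, k i)) (Z : forall i, set 'cV[R]_(k i))
    (l : forall i, 'cV[R]_n -> 'cV[R]_(L i)) (Gamma : nat) :
    program R 'cV[R]_n :=
  {| aux := ('cV[R]_m * R)%type;
     feasible := [set w : 'cV[R]_n * ('cV[R]_m * R) | let: (x, (p, theta)) := w in
       [/\ X x,
           forall i, (support_fun (Z i) ((A i)^T *m l i x)
                      <= (p i ord0 + theta)%:E)%E,
           forall i, 0 <= p i ord0 & 0 <= theta]];
     objective := fun w : 'cV[R]_n * ('cV[R]_m * R) => let: (x, (p, theta)) := w in
       (Gamma%:R * theta
        + \sum_(i < m) (dotv (ubar i) (l i x) + p i ord0))%:E |}.

(* Main.v *)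
Require Import Defs.
From mathcomp Require Import all_boot all_order all_algebra archimedean.
From mathcomp Require Import all_classical all_reals all_analysis.
Import Order.TTheory GRing.Theory Num.Theory.
Import numFieldNormedType.Exports.
Local Open Scope classical_set_scope.
Local Open Scope ring_scope.

(** Fix [x] in [X], let [c_i] be the product of [ubar i] with [l i x] and let
    [d_i] be the support function of [Z i] at [(A i)^T *m l i x].  As [U i] is
    the image of [Z i] under [z |-> ubar i + A i *m z], the worst case of [f i]
    at [x] is [c_i + d_i] ([sup_affine_image]), and [d_i >= 0] because [ubar i]
    is itself one of the points of [U i] ([support_fun_ge0]).  The objective of
    the counterpart at [x] is therefore
      [\sum_i c_i + sup_(#|S| <= Gamma) \sum_(i in S) d_i].

    If some [d_i] is infinite, this is [+oo], the singleton of [i] being allowed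
    since [Gamma >= 1], and no [(p, theta)] is feasible for [x].  Otherwise the
    second term is the sum of the [Gamma] largest [d_i], and linear programming
    duality writes it as the minimum of [Gamma * theta + \sum_i p_i] under
    [d_i <= p_i + theta], [p >= 0] and [theta >= 0].  Weak duality is
    [sum_subset_le_threshold]; the minimum is attained at a threshold [theta]
    separating the [Gamma] largest [d_i] from the others, with
    [p_i = max(0, d_i - theta)] ([exists_threshold]).

    Because the minimum is attained, each feasible point of one program can be
    matched, without changing [x] or increasing the objective, by a feasible
    point of the other.  Such mutual domination yields equality of the values
    and of the sets of optimal [x] ([dominates_program_equiv]). *)

(** Points of value [+oo] are exempt, since a constraint violation in one
    program may show up as the value [+oo] in the other. *)
Definition dominates {R : realType} {V : Type} (P Q : program R V) : Prop :=
  forall x a, feasible (p := Q) (x, a) -> (objective (p := Q) (x, a) < +oo)%E ->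
  exists2 b, feasible (p := P) (x, b)
           & (objective (p := P) (x, b) <= objective (p := Q) (x, a))%E.

Lemma dominates_optimal_value {R : realType} {V : Type} {P Q : program R V} :
  dominates P Q -> (optimal_value P <= optimal_value Q)%E.
Proof.
move=> PQ; apply: le_ereal_inf_tmp => _ [[x a] feas <-].
have [fin|] := ltP (objective (p := Q) (x, a)) +oo%E; last first.
  by rewrite leye_eq => /eqP ->; rewrite leey.
have [b feasb leb] := PQ x a feas fin.
by apply: ge_ereal_inf; exists (objective (p := P) (x, b)) => //; exists (x, b).
Qed.

(** A domination between programs of equal value carries an optimal point of the
    dominated program to a feasible point whose value cannot exceed, hence
    equals, the optimum; finiteness of the value makes the point eligible. *)
Lemma dominates_attains {R : realType} {V : Type} {P Q : program R V} (x : V) :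
  dominates P Q -> optimal_value P = optimal_value Q ->
  optimal_value Q \is a fin_num -> attains Q x -> attains P x.
Proof.
move=> PQ eqv finQ [a [feas opt]].
have fin : (objective (p := Q) (x, a) < +oo)%E by rewrite opt ltey_eq finQ.
have [b feasb leb] := PQ x a feas fin.
exists b; split => //; apply/eqP; rewrite eq_le; apply/andP; split.
  by rewrite eqv -opt.
by apply: ereal_inf_lbound; exists (x, b).
Qed.

Lemma dominates_program_equiv {R : realType} {V : Type} (X : set V)
    (P Q : program R V) :
  dominates P Q -> dominates Q P -> program_equiv X P Q.
Proof.
move=> PQ QP.
have eqv : optimal_value P = optimal_value Q.
  by apply/eqP; rewrite eq_le !dominates_optimal_value.
by split=> // fin x _; split; apply: dominates_attains; rewrite -?eqv.
Qed.

(** Greedy choice: enlarging [S] by a maximizer [i] of [d] outside [S] keeps [S]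
    made of largest entries, and [d i] is the new threshold. *)
Lemma exists_largest_subset {R : realDomainType} {I : finType} (d : I -> R)
    (k : nat) :
  (forall i, 0 <= d i) -> (k <= #|I|)%N ->
  exists (S : {set I}) (t : R),
    [/\ #|S| = k, 0 <= t, forall i, i \in S -> t <= d i
      & forall i, i \notin S -> d i <= t].
Proof.
move=> d0; elim: k => [_|k IHk ltk].
  (* Any upper bound of d is a threshold for the empty set. *)
  exists (finset.set0 : {set I}), (\sum_i d i); split; rewrite ?cards0 ?sumr_ge0 //.
    by move=> i; rewrite inE.
  by move=> i _; rewrite (bigD1 i) //= lerDl sumr_ge0.
have [S [t [cardS t0 inS outS]]] := IHk (ltnW ltk).
have /card_gt0P [i0] : (0 < #|~: S|)%N.
  by rewrite -(ltn_add2l #|S|) cardsC addn0 cardS.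
rewrite inE => i0S.
have [i iS max_i] := @arg_maxP _ _ _ i0 (fun i => i \notin S) d i0S.
exists (i |: S), (d i); split => //.
- by rewrite cardsU1 iS cardS.
- by move=> j; rewrite in_setU1 => /orP [/eqP -> //|jS]; apply: le_trans (inS j jS); apply: outS.
- by move=> j; rewrite in_setU1 negb_or => /andP [_]; apply: max_i.
Qed.

(** Weak duality: summing the constraints over [S] costs at most [k] times [t],
    and the [p i] outside [S] only add to the right-hand side. *)
Lemma sum_subset_le_threshold {R : realDomainType} {I : finType} (d p : I -> R)
    (t : R) (k : nat) (S : {set I}) :
  (forall i, d i <= p i + t) -> (forall i, 0 <= p i) -> 0 <= t ->
  (#|S| <= k)%N ->
  \sum_(i in S) d i <= k%:R * t + \sum_i p i.
Proof.
move=> dpt p0 t0 Sk; apply: le_trans (ler_sum _ (fun i _ => dpt i)) _.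
rewrite big_split [leLHS]addrC /= sumr_const -[t *+ _]mulr_natl.
apply: lerD; first by rewrite ler_wpM2r ?ler_nat.
by rewrite [leRHS](bigID (mem S)) /= lerDl sumr_ge0.
Qed.

(** Strong duality with attainment, by complementary slackness: [p i] vanishes
    off [S], and the constraints indexed by [S] are tight. *)
Lemma exists_threshold {R : realDomainType} {I : finType} (d : I -> R) (k : nat) :
  (forall i, 0 <= d i) -> (k <= #|I|)%N ->
  exists (S : {set I}) (p : I -> R) (t : R),
    [/\ (#|S| <= k)%N, forall i, d i <= p i + t, forall i, 0 <= p i, 0 <= t
      & k%:R * t + \sum_i p i = \sum_(i in S) d i].
Proof.
move=> d0 leq_k; have [S [t [cardS t0 inS outS]]] := exists_largest_subset d k d0 leq_k.
exists S, (fun i => if i \in S then d i - t else 0), t; split => //.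
- by rewrite cardS.
- by move=> i; case: ifPn => [_|/outS]; rewrite /= ?subrK ?add0r.
- by move=> i; case: ifPn => // /inS; rewrite subr_ge0.
- by rewrite -big_mkcond sumrB sumr_const cardS -[t *+ k]mulr_natl addrC subrK.
Qed.

Lemma ereal_sup_addl {R : realType} (T : Type) (D : set T) (c : R) (g : T -> R) :
  D !=set0 ->
  ereal_sup [set (c + g y)%:E | y in D]
    = (c%:E + ereal_sup [set (g y)%:E | y in D])%E.
Proof.
move=> [y0 Dy0]; apply/eqP; rewrite eq_le; apply/andP; split.
  apply: ge_ereal_sup => _ [y Dy <-].
  by rewrite EFinD leeD2l //; apply: ereal_sup_ubound; exists y.
rewrite addeC -leeBrDr //; apply: ge_ereal_sup => _ [y Dy <-].
by rewrite leeBrDr // addeC -EFinD; apply: ereal_sup_ubound; exists y.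
Qed.

Lemma dotvDl {R : realType} (k : nat) (u v w : 'cV[R]_k) :
  dotv (u + v) w = dotv u w + dotv v w.
Proof. by rewrite /dotv linearD mulmxDl mxE. Qed.

Lemma dotv_mulmxl {R : realType} (k j : nat) (A : 'M[R]_(k, j)) (z : 'cV[R]_j)
    (w : 'cV[R]_k) : dotv (A *m z) w = dotv z (A^T *m w).
Proof. by rewrite /dotv trmx_mul mulmxA. Qed.

Lemma dotv0l {R : realType} (k : nat) (w : 'cV[R]_k) : dotv 0 w = 0.
Proof. by rewrite /dotv trmx0 mul0mx mxE. Qed.

(** The supremum of a linear function over an affine image splits into its value
    at the offset and a support function, by transposing [A]. *)
Lemma sup_affine_image {R : realType} (k j : nat) (u : 'cV[R]_k)
    (A : 'M[R]_(k, j)) (Z : set 'cV[R]_j) (w : 'cV[R]_k) :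
  Z !=set0 ->
  ereal_sup [set (dotv v w)%:E | v in [set u + A *m z | z in Z]]
    = ((dotv u w)%:E + support_fun Z (A^T *m w))%E.
Proof.
move=> Z0; rewrite -ereal_sup_addl // image_comp; congr ereal_sup.
by apply: eq_imagel => z _ /=; rewrite dotvDl dotv_mulmxl.
Qed.

(** If the offset [u] lies in the affine image then [A *m z = 0] for some [z] in
    [Z], and this [z] contributes the value 0 to the supremum. *)
Lemma support_fun_ge0 {R : realType} (k j : nat) (u : 'cV[R]_k)
    (A : 'M[R]_(k, j)) (Z : set 'cV[R]_j) (w : 'cV[R]_k) :
  [set u + A *m z | z in Z] u -> (0 <= support_fun Z (A^T *m w))%E.
Proof.
move=> [z Zz /eqP]; rewrite -subr_eq0 addrAC subrr add0r => /eqP Az0.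
apply: ereal_sup_ubound; exists z => //.
by rewrite -dotv_mulmxl Az0 dotv0l.
Qed.

(** Each index carries its nominal value [c i], and those in [S] pay the
    deviation [d i] on top, so the nominal total leaves the supremum over [S]. *)
Lemma gamma_counterpart_objectiveE (R : realType) (n m : nat) (X : set 'cV[R]_n)
    (L : 'I_m -> nat) (U : forall i : 'I_m, set 'cV[R]_(L i))
    (ubar : forall i : 'I_m, 'cV[R]_(L i))
    (f : forall i : 'I_m, 'cV[R]_n -> 'cV[R]_(L i) -> R) (Gamma : nat)
    (x : 'cV[R]_n) (c : 'I_m -> R) (d : 'I_m -> \bar R) :
  (forall i, f i x (ubar i) = c i) ->
  (forall i, ereal_sup [set (f i x u)%:E | u in U i] = ((c i)%:E + d i)%E) ->
  objective (p := gamma_counterpart X U ubar f Gamma) (x, tt)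
    = ereal_sup [set ((\sum_i c i)%:E + \sum_(i in S) d i)%E
                | S in [set S : {set 'I_m} | (#|S| <= Gamma)%N]].
Proof.
move=> fc fd; congr ereal_sup; apply: eq_imagel => S _ /=.
under eq_bigr do rewrite fd.
under [X in (_ + X)%E]eq_bigr do rewrite fc.
rewrite big_split /= addeAC -sumEFin; congr (_ + _)%E.
rewrite [RHS](bigID (mem S)) /=; congr (_ + _)%E.
by apply: eq_bigl => i; rewrite finset.in_setC.
Qed.

Theorem corollary3p8 (R : realType) (n m p : nat)
    (hn : (1 <= n)%N) (hm : (1 <= m)%N) (hp : (p <= n)%N)
    (X : set 'cV[R]_n) (hX : X `<=` @mixed_integer R n p)
    (L : 'I_m -> nat) (U : forall i : 'I_m, set 'cV[R]_(L i))
    (ubar : forall i : 'I_m, 'cV[R]_(L i))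
    (hubar : forall i : 'I_m, U i (ubar i))
    (f : forall i : 'I_m, 'cV[R]_n -> 'cV[R]_(L i) -> R)
    (k : 'I_m -> nat) (A : forall i : 'I_m, 'M[R]_(L i, k i))
    (Z : forall i : 'I_m, set 'cV[R]_(k i))
    (hZ : forall i : 'I_m, convex_set (Z i))
    (hU : forall i : 'I_m, U i = [set ubar i + A i *m zeta | zeta in Z i])
    (l : forall i : 'I_m, 'cV[R]_n -> 'cV[R]_(L i))
    (hf : forall (i : 'I_m) (x : 'cV[R]_n) (u : 'cV[R]_(L i)),
        X x -> U i u -> f i x u = dotv u (l i x))
    (hri : forall i : 'I_m, relative_interior (U i) (ubar i))
    (Gamma : nat) (hGamma : (1 <= Gamma <= m)%N) :
  program_equiv X (gamma_counterpart X U ubar f Gamma)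
                  (gamma_reformulation X ubar A Z l Gamma).
Proof.
pose c (x : 'cV[R]_n) i := dotv (ubar i) (l i x).
pose d (x : 'cV[R]_n) i := support_fun (Z i) ((A i)^T *m l i x).
have d_ge0 x i : (0 <= d x i)%E.
  by apply: (support_fun_ge0 _ _ (ubar i)); rewrite -hU; exact: hubar.
have d_fin x i : (d x i < +oo)%E -> d x i = (fine (d x i))%:E.
  by move=> dlt; rewrite fineK // ge0_fin_numE.
have objE x : X x -> objective (p := gamma_counterpart X U ubar f Gamma) (x, tt)
    = ereal_sup [set ((\sum_i c x i)%:E + \sum_(i in S) d x i)%E
                | S in [set S : {set 'I_m} | (#|S| <= Gamma)%N]].
  move=> Xx; apply: gamma_counterpart_objectiveE => i; first exact: hf.
  rewrite -sup_affine_image; last first.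
    by have := hubar i; rewrite hU => -[z Zz _]; exists z.
  rewrite -hU; congr ereal_sup; apply: eq_imagel => u Uu /=.
  by rewrite hf.
have objQE x (q : 'cV[R]_m) t :
    Gamma%:R * t + \sum_(i < m) (dotv (ubar i) (l i x) + q i ord0)
    = \sum_i c x i + (Gamma%:R * t + \sum_i q i ord0).
  by rewrite big_split /= addrCA.
apply: dominates_program_equiv.
(* Weak duality bounds every budgeted sum by the reformulated objective. *)
- move=> x [q t] [Xx dqt q0 t0] _; exists tt => //; rewrite objE // [leRHS]/= objQE.
  have dE i : d x i = (fine (d x i))%:E.
    by apply: d_fin; apply: le_lt_trans (dqt i) (ltey _).
  apply: ge_ereal_sup => _ [S leS <-].
  rewrite (eq_bigr _ (fun i _ => dE i)).
  rewrite sumEFin -EFinD lee_fin lerD2l; apply: sum_subset_le_threshold => // i.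
  by rewrite -lee_fin -dE; exact: dqt.
(* A finite robust value makes strong duality available. *)
- move=> x [] Xx; rewrite objE // => fin.
  have dE i : d x i = (fine (d x i))%:E.
    apply: d_fin; rewrite ltNge leye_eq; apply: contraTN fin => /eqP diy.
    rewrite -leNgt; apply: le_ereal_sup_tmp; exists +oo%E => //.
    (* Gamma >= 1 allows the singleton, which alone has an infinite sum. *)
    exists [set i]%SET; first by rewrite /= cards1; case/andP: hGamma.
    by rewrite big_set1 diy.
  have [i||S [q [t [leS dqt q0 t0 eqS]]]] :=
    exists_threshold (fun i => fine (d x i)) Gamma.
  + exact: fine_ge0.
  + by rewrite card_ord; case/andP: hGamma.
  have qE i : (\col_j q j : 'cV[R]_m) i ord0 = q i by rewrite mxE.
  exists (\col_i q i, t).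
    split=> // i; last by rewrite qE.
    by rewrite qE -/(d x i) dE lee_fin.
  rewrite [leLHS]/= objQE; under [X in _ + (_ + X)]eq_bigr do rewrite qE.
  rewrite eqS EFinD.
  have -> : (\sum_(i in S) fine (d x i))%:E = (\sum_(i in S) d x i)%E.
    by rewrite -sumEFin; apply: eq_bigr => i _; rewrite -dE.
  by apply: ereal_sup_ubound; exists S.
Qed.
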